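(* Let $d\ge 2$, let $U$ be a unitary operator on $\mathbb{C}^d$, and let $\Pi=\{\Pi_1,\ldots,\Pi_k\}$ be a rank-$1$ POVM on $\mathbb{C}^d$. Let $\mathbb{P}_*$ be the Kusuoka measure on $\{1,\ldots,k\}^{\mathbb{N}}$ induced by $U$ and $\Pi$. The following conditions are equivalent: (i) $\mathbb{P}_*$ is ergodic; (ii) $\{\sqrt{\Pi_1}\,U,\ldots,\sqrt{\Pi_k}\,U\}$ is irreducible; (iii) there is no non-trivial linear subspace $W$ of $\mathbb{C}^d$ such that $U(W)=W$ and $\varphi_i\in W\cup W^\perp$ for every $i\in\{1,\ldots,k\}$, where $\varphi_i$ is the unit vector associated with $\Pi$ via $\operatorname{im}\Pi_i=\operatorname{span}\{\varphi_i\}$, $i\in\{1,\ldots,k\}$; (iv) the transition matrix $[\mathsf{p}_j(\rho_i)]_{i,j\in\{1,\ldots,k\}}$ is irreducible.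
   Context: A POVM on $\mathbb{C}^d$ with $k$ outcomes is a set $\{\Pi_1,\ldots,\Pi_k\}$ of non-zero positive semi-definite operators on $\mathbb{C}^d$ with $\sum_{i=1}^k\Pi_i=\mathbb{I}$. It is called a (normalised) rank-$1$ POVM if $\operatorname{tr}\Pi_1=\cdots=\operatorname{tr}\Pi_k$ and $\operatorname{rank}\Pi_i=1$ for every $i$; then necessarily $\operatorname{tr}\Pi_i=d/k$ and $k\ge d$, and there are unit vectors $\varphi_1,\ldots,\varphi_k\in\mathbb{C}^d$ such that $\Pi_i=\frac dk\rho_i$, where $\rho_i$ is the orthogonal projection onto $\operatorname{span}\{\varphi_i\}$. Let $\rho_*:=\mathbb{I}/d$. The Kusuoka measure $\mathbb{P}_*$ induced by $U$ and $\Pi$ is the unique probability measure on $\{1,\ldots,k\}^{\mathbb{N}}$ (with the $\sigma$-algebra generated by all cylinder sets) such that for every $n\ge 1$ and $(i_1,\ldots,i_n)\in\{1,\ldots,k\}^n$, $$\mathbb{P}_*(C_{(i_1,\ldots,i_n)})=\operatorname{tr}\left(\sqrt{\Pi_{i_n}}\,U\cdots\sqrt{\Pi_{i_1}}\,U\rho_*U^*\sqrt{\Pi_{i_1}}\cdots U^*\sqrt{\Pi_{i_n}}\right),$$ where $C_{(i_1,\ldots,i_n)}:=\{(s_j)_{j=1}^\infty : s_1=i_1,\ldots,s_n=i_n\}$. This measure is invariant under the left shift, and ergodicity is understood with respect to the left shift. A family $\{A_1,\ldots,A_k\}$ of linear maps on $\mathbb{C}^d$ is irreducible if there is no non-trivial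 subspace of $\mathbb{C}^d$ (i.e. different from $\{0\}$ and $\mathbb{C}^d$) that is invariant under $A_i$ for every $i$ (a subspace $V$ is invariant under $A$ if $A(V)\subset V$). For a state $\rho$ (positive semi-definite operator of trace $1$), $\mathsf{p}_j(\rho):=\operatorname{tr}(\Pi_jU\rho U^* )$; in particular $\mathsf{p}_j(\rho_i)=\frac dk|\langle\varphi_j,U\varphi_i\rangle|^2$. The matrix $[\mathsf{p}_j(\rho_i)]_{i,j}$ (row index $i$, column index $j$) is stochastic. A stochastic matrix $Q$ is irreducible if for all $i,j$ there is $n\ge1$ with $(Q^n)_{ij}>0$. *)

(* Defs.v *)
(* MathComp with MathComp-Analysis.  Operators on C^d are matrices acting on
   column vectors; C is instantiated with R[i] for R : realType. *)
From HB Require Import structures.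
From mathcomp Require Import all_boot all_order all_algebra.
From mathcomp Require Import complex.
From mathcomp Require Import all_classical all_reals all_analysis.

Set Implicit Arguments.
Unset Strict Implicit.
Unset Printing Implicit Defensive.

Import Order.TTheory GRing.Theory Num.Theory.
Local Open Scope classical_set_scope.
Local Open Scope ring_scope.
Local Open Scope complex_scope.
Local Open Scope sesquilinear_scope.

Section Operators.
Variable C : numClosedFieldType.

Definition opfun d (A : 'M[C]_d) : 'End('cV[C]_d) := linfun (mulmx A).

Definition dotc d (u v : 'cV[C]_d) : C := (u ^t* *m v) 0 0.

(* The complex order makes [0 <= z] include the reality of z. *)
Definition psdmx d (A : 'M[C]_d) : Prop :=
  A \is hermsymmx /\ forall v : 'cV[C]_d, 0 <= dotc v (A *m v).

Definition sqrtmx d (A : 'M[C]_d) : 'M[C]_d :=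
  invmx (spectralmx A) *m diag_mx (map_mx sqrtC (spectral_diag A))
    *m spectralmx A.

Lemma sqrtmxP d (A : 'M[C]_d) :
  psdmx A -> psdmx (sqrtmx A) /\ sqrtmx A *m sqrtmx A = A.
Proof.
move=> [Ah Apos].
have An := hermitian_normalmx Ah.
have Ae := orthomx_spectralP An.
set P := spectralmx A in Ae *; set D := spectral_diag A in Ae *.
have Pu : P \in unitmx by exact: spectral_unit.
have Pi : invmx P = P ^t* by rewrite invmx_unitary// spectral_unitarymx.
have dotA (E : 'rV[C]_d) (v : 'cV[C]_d) :
    dotc v (invmx P *m diag_mx E *m P *m v)
    = \sum_i E 0 i * (`|(P *m v) i 0| ^+ 2).
  rewrite /dotc -!mulmxA (_ : v ^t* *m _ = (P *m v) ^t* *m (diag_mx E *m (P *m v))).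
    rewrite mxE; apply: eq_bigr => i _.
    by rewrite mul_diag_mx !mxE normCK mulrCA [X in _ * X]mulrC.
  by rewrite Pi trmx_mul map_mxM !mulmxA.
have D0 i : 0 <= D 0 i.
  have := Apos (invmx P *m delta_mx i 0).
  rewrite {1}Ae dotA (bigD1 i)//= big1 ?addr0 => [|j ji].
    by rewrite mulKVmx// mxE !eqxx normr1 expr1n mulr1.
  by rewrite mulKVmx// mxE (negbTE ji) normr0 expr0n mulr0.
split; last first.
  rewrite /sqrtmx -/P -/D -!mulmxA mulKVmx// [in RHS]Ae -!mulmxA.
  congr (_ *m _); rewrite mulmxA; congr (_ *m _).
  rewrite mulmx_diag; congr diag_mx; apply/rowP => i.
  by rewrite !mxE -expr2 sqrtCK.
split; last first.
  move=> v; rewrite /sqrtmx -/P -/D dotA; apply: sumr_ge0 => i _.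
  by rewrite mulr_ge0 ?exprn_ge0// mxE sqrtC_ge0.
apply/is_hermitianmxP; rewrite expr0 scale1r /sqrtmx -/P -/D Pi.
rewrite !trmx_mul !map_mxM trmxCK mulmxA; congr (_ *m _ *m _).
rewrite tr_diag_mx map_diag_mx; congr diag_mx; apply/rowP => i.
by rewrite !mxE /= geC0_conj// sqrtC_ge0.
Qed.

(* Outcomes are labelled: distinct outcomes may carry equal effects. *)
Definition is_povm d k (Pi : 'I_k -> 'M[C]_d) : Prop :=
  (forall i, psdmx (Pi i) /\ Pi i <> 0) /\ \sum_i Pi i = 1%:M.

Definition is_rank1_povm d k (Pi : 'I_k -> 'M[C]_d) : Prop :=
  [/\ is_povm Pi, forall i j, \tr (Pi i) = \tr (Pi j)
    & forall i, \rank (Pi i) = 1%N].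

Definition povm_vectors d k (Pi : 'I_k -> 'M[C]_d) (phi : 'I_k -> 'cV[C]_d) :
    Prop :=
  forall i, dotc (phi i) (phi i) = 1 /\ limg (opfun (Pi i)) = <[phi i]>%VS.

Definition orthoproj1 d (phi : 'cV[C]_d) : 'M[C]_d := phi *m phi ^t*.

Lemma orthoproj1P d (phi : 'cV[C]_d) : dotc phi phi = 1 ->
  [/\ orthoproj1 phi \is hermsymmx,
      orthoproj1 phi *m orthoproj1 phi = orthoproj1 phi
    & limg (opfun (orthoproj1 phi)) = <[phi]>%VS].
Proof.
move=> phi1.
have pp : phi ^t* *m phi = 1%:M by rewrite [LHS]mx11_scalar -/(dotc phi phi) phi1.
split.
- by apply/is_hermitianmxP; rewrite expr0 scale1r trmx_mul map_mxM trmxCK.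
- by rewrite /orthoproj1 -mulmxA (mulmxA _ phi) pp mul1mx.
- apply/eqP; rewrite eqEsubv; apply/andP; split; apply/subvP => v.
    move=> /memv_imgP[u _ ->]; rewrite lfunE /= /orthoproj1 -mulmxA.
    rewrite [X in phi *m X]mx11_scalar mul_mx_scalar.
    by rewrite memvZ// memv_line.
  move=> /vlineP[a ->]; apply/memvZ/memv_imgP; exists phi; first exact: memvf.
  by rewrite lfunE /= /orthoproj1 -mulmxA pp mulmx1.
Qed.

Definition in_orthov d (W : {vspace 'cV[C]_d}) (v : 'cV[C]_d) : Prop :=
  forall w, w \in W -> dotc w v = 0.

Definition nontrivial_vspace d (W : {vspace 'cV[C]_d}) : Prop :=
  W <> 0%VS /\ W <> fullv.

Definition irreducible_family d k (A : 'I_k -> 'M[C]_d) : Prop :=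
  ~ exists W : {vspace 'cV[C]_d},
      nontrivial_vspace W /\ forall i, (opfun (A i) @: W <= W)%VS.

Definition outcome_prob d k (U : 'M[C]_d) (Pi : 'I_k -> 'M[C]_d)
    (j : 'I_k) (rho : 'M[C]_d) : C :=
  \tr (Pi j *m U *m rho *m U ^t*).

Definition transition_mx d k (U : 'M[C]_d) (Pi : 'I_k -> 'M[C]_d)
    (phi : 'I_k -> 'cV[C]_d) : 'M[C]_k :=
  \matrix_(i, j) outcome_prob U Pi j (orthoproj1 (phi i)).

Definition irreducible_stochastic k (Q : 'M[C]_k) : Prop :=
  forall i j, exists n, (0 < n)%N /\ 0 < (Q ^+ n) i j.

End Operators.

Section Sequences.

Definition cylinder (k n : nat) (w : n.-tuple 'I_k) : set (nat -> 'I_k) :=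
  [set s | forall j : 'I_n, s j = tnth w j].

Definition cylinders (k : nat) : set (set (nat -> 'I_k)) :=
  [set A | exists n (w : n.+1.-tuple 'I_k), A = cylinder w].
Arguments cylinders : clear implicits.

(* The library's measurable types are pointed, hence the k.+1 outcomes. *)
HB.instance Definition _ (k : nat) := isPointed.Build 'I_k.+1 ord0.

Definition seq_space (k : nat) : measurableType (cylinders k.+1).-sigma :=
  g_sigma_algebraType (cylinders k.+1).

Definition left_shift (T : Type) (s : nat -> T) : nat -> T := fun n => s n.+1.

Definition ergodic (R : realType) (d : measure_display) (T : measurableType d)
    (P : probability T R) (f : T -> T) : Prop :=
  [/\ measurable_fun setT f,
      forall A, measurable A -> P (f @^-1` A) = P A
    & forall A, measurable A -> f @^-1` A = A -> P A = 0%E \/ P A = 1%E].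

End Sequences.

Section Kusuoka.
Variables (R : realType) (d k : nat).
Variables (U : 'M[R[i]]_d) (Pi : 'I_k.+1 -> 'M[R[i]]_d).

(* Unnormalised state after the outcomes of w, read from left to right. *)
Definition post_state (rho : 'M[R[i]]_d) (w : seq 'I_k.+1) : 'M[R[i]]_d :=
  foldl (fun r i => sqrtmx (Pi i) *m U *m r *m U ^t* *m sqrtmx (Pi i)) rho w.

Definition is_kusuoka_measure (P : probability (seq_space k) R) : Prop :=
  forall n (w : n.+1.-tuple 'I_k.+1),
    (fine (P (cylinder w)))%:C = \tr (post_state (d%:R^-1)%:M w).

End Kusuoka.

(* Main.v *)
Require Import Defs.
From HB Require Import structures.
From mathcomp Require Import all_boot all_order all_algebra.
From mathcomp Require Import complex.
From mathcomp Require Import all_classical all_reals all_analysis.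

(** Why the four conditions agree.  Write c = d/k, so that each effect is
    c times the projection rho_i onto the line of phi_i, and let Q be the
    matrix of transition probabilities Q_ij = c |<phi_j, U phi_i>|^2, which is
    doubly stochastic.  Everything is compared with one combinatorial
    condition: a set S of outcomes is absorbing when Q_ab = 0 for a in S and
    b outside S, and no nonempty absorbing set may be proper.

    For Q itself this is the usual reformulation of irreducibility
    ([irreducible_stochasticP]): the outcomes reachable from a given one form
    an absorbing set.

    On the linear side, a subspace V invariant under all sqrt(Pi_i) U yields
    the absorbing set of all a with phi_a in V, because phi_b must lie in V as
    soon as <phi_b, U v> is nonzero for some v in V
    ([no_proper_absorbing_irreducible]).  A subspace splitting the frame is
    invariant under all these operators ([irreducible_no_split]).  Finally the
    span W of the phi_a, a in a proper absorbing S, satisfies U W = W and is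
    orthogonal to phi_b for b outside S, so W splits the frame
    ([no_split_no_proper_absorbing]).

    On the probabilistic side, a measurement of rank 1 forgets the state:
    sqrt(Pi_j) X sqrt(Pi_j) = tr(Pi_j X) rho_j ([luders_instrumentE]).  Hence
    the Kusuoka measure is the law of the Markov chain with transition matrix
    Q started from the uniform distribution ([kusuoka_uniform_markov]).  For
    such a chain the Markov property
      P(x_0 = i, shift x in B) = sum_j Q_ij P(x_0 = j, x in B)
    ([markov_step]) gives shift invariance, and shows for an invariant event A
    that i |-> P(x_0 = i, A) is Q-harmonic.  If no absorbing set is proper,
    such a function is constant (its argmax set is absorbing), so A is
    independent of every cylinder, hence of itself, and P(A) is 0 or 1
    ([no_proper_absorbing_ergodic]).  Conversely, by double stochasticity the
    complement of an absorbing set S is absorbing too, so the invariant event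
    that S is visited infinitely often agrees almost surely with x_0 in S,
    whose probability lies strictly between 0 and 1 when S is nonempty and
    proper ([ergodic_no_proper_absorbing]). *)

Set Implicit Arguments.
Unset Strict Implicit.
Unset Printing Implicit Defensive.

Import Order.TTheory GRing.Theory Num.Theory.
Local Open Scope ring_scope.

(** * Absorbing sets of a stochastic matrix *)

Section AbsorbingSets.

Definition absorbing (E : nmodType) k (Q : 'M[E]_k) (S : {set 'I_k}) : Prop :=
  forall a b, a \in S -> b \notin S -> Q a b = 0.

Definition no_proper_absorbing (E : nmodType) k (Q : 'M[E]_k) : Prop :=
  forall S : {set 'I_k}, absorbing Q S -> forall a b, a \in S -> b \in S.

(** A path of positive probability cannot leave an absorbing set; conversely
    the outcomes reachable from [i] in at least one step form an absorbing set,
    nonempty because the row of [i] does not vanish. *)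
Lemma irreducible_stochasticP (C : numClosedFieldType) k (Q : 'M[C]_k) :
  (forall i j, 0 <= Q i j) -> (forall i, \sum_j Q i j = 1) ->
  irreducible_stochastic Q <-> no_proper_absorbing Q.
Proof.
move=> Q0 Q1.
have QX0 n i j : 0 <= (Q ^+ n) i j.
  elim: n i j => [|n IHn] i j; first by rewrite expr0 mxE ler0n.
  by rewrite exprSr mxE sumr_ge0// => l _; rewrite mulr_ge0.
split=> [Qirr S Sabs a c aS | Qabs i j].
  have stay n b : b \notin S -> (Q ^+ n) a b = 0.
    elim: n b => [|n IHn] b bS.
      by rewrite expr0 mxE; case: eqP aS bS => // <- ->.
    rewrite exprSr mxE big1// => l _; have [lS|lS] := boolP (l \in S).
      by rewrite (Sabs l b)// mulr0.
    by rewrite IHn// mul0r.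
  apply/negPn/negP => bS.
  by have [n [_]] := Qirr a c; rewrite stay// ltxx.
pose S := [set j | `[< exists n, (0 < n)%N /\ 0 < (Q ^+ n) i j >]].
have [l Sl] : exists l, l \in S.
  have [/existsP[l Ql]|] := boolP [exists l, 0 < Q i l].
    by exists l; rewrite inE; apply/asboolP; exists 1%N; rewrite expr1.
  rewrite negb_exists => /forallP Qi; have /eqP := Q1 i.
  rewrite big1 => [|l _]; first by rewrite eq_sym oner_eq0.
  by apply/eqP; move: (Qi l); rewrite lt_def Q0 andbT negbK.
suff Sabs : absorbing Q S.
  by have := Qabs S Sabs l j Sl; rewrite inE => /asboolP.
move=> a b.
rewrite !inE => -[n [n0 Qn]]; apply: contraNeq => Qab; apply/asboolP.
exists n.+1; split=> //.
rewrite exprSr mxE (bigD1 a)//= ltr_pwDl//.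
  by rewrite mulr_gt0// lt_def Qab Q0.
by rewrite sumr_ge0// => m _; rewrite mulr_ge0.
Qed.

End AbsorbingSets.

(** * Rank-1 Hermitian operators and their square roots *)

Section Hermitian.
Local Open Scope sesquilinear_scope.
Variable C : numClosedFieldType.

Lemma dotcC d (u v : 'cV[C]_d) : dotc v u = (dotc u v)^*.
Proof.
rewrite /dotc !mxE rmorph_sum; apply: eq_bigr => i _.
by rewrite !mxE rmorphM /= conjCK mulrC.
Qed.

Lemma dotcZr d (u v : 'cV[C]_d) a : dotc u (a *: v) = a * dotc u v.
Proof. by rewrite /dotc -scalemxAr mxE. Qed.

Lemma dotc0r d (u : 'cV[C]_d) : dotc u 0 = 0.
Proof. by rewrite /dotc mulmx0 mxE. Qed.

Lemma mxC_sqr0 m n (M : 'M[C]_(m, n)) : M ^t* *m M = 0 -> M = 0.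
Proof.
move=> M0; apply/matrixP => i j; rewrite mxE.
have := congr1 (fun B : 'M[C]_(n, n) => B j j) M0; rewrite !mxE.
have E l : true -> (M ^t* ) j l * M l j = `|M l j| ^+ 2.
  by move=> _; rewrite !mxE mulrC normCK.
rewrite (eq_bigr _ E) => /eqP; rewrite psumr_eq0 => [/allP/(_ i)|l _].
  by rewrite mem_index_enum expf_eq0 normr_eq0 => /(_ isT)/eqP.
by rewrite exprn_ge0.
Qed.

Lemma orthoproj1_mul d (phi v : 'cV[C]_d) :
  orthoproj1 phi *m v = dotc phi v *: phi.
Proof.
by rewrite /orthoproj1 -mulmxA [phi ^t* *m v]mx11_scalar mul_mx_scalar.
Qed.

(** For p = phi phi^*, the middle factor of p X p is the scalar phi^* X phi. *)
Lemma orthoproj1_sandwich d (phi : 'cV[C]_d) (X : 'M[C]_d) :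
  orthoproj1 phi *m X *m orthoproj1 phi
  = \tr (orthoproj1 phi *m X) *: orthoproj1 phi.
Proof.
have -> : \tr (orthoproj1 phi *m X) = (phi ^t* *m X *m phi) 0 0.
  by rewrite /orthoproj1 -mulmxA mxtrace_mulC [X in \tr X]mx11_scalar mxtrace_scalar.
rewrite {1 2}/orthoproj1 !mulmxA -[phi *m _ *m X *m phi]mulmxA.
by rewrite -!(mulmxA phi) [X in phi *m (X *m _)]mx11_scalar mul_scalar_mx -scalemxAr mulmxA.
Qed.

Lemma mxtrace_orthoproj1 d (phi : 'cV[C]_d) : \tr (orthoproj1 phi) = dotc phi phi.
Proof.
by rewrite /orthoproj1 mxtrace_mulC [X in \tr X]mx11_scalar mxtrace_scalar.
Qed.

Lemma orthoproj1_herm d (phi : 'cV[C]_d) : (orthoproj1 phi) ^t* = orthoproj1 phi.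
Proof. by rewrite /orthoproj1 trmx_mul map_mxM trmxCK. Qed.

Lemma hermsymmx_adjoint d (A : 'M[C]_d) : A \is hermsymmx -> A ^t* = A.
Proof. by move=> /is_hermitianmxP; rewrite expr0 scale1r => <-. Qed.

(** Taking adjoints turns p A = A into A p = A, so that A = p A p. *)
Lemma hermitian_lineE d (phi : 'cV[C]_d) (A : 'M[C]_d) :
  dotc phi phi = 1 -> A ^t* = A -> orthoproj1 phi *m A = A ->
  A = \tr A *: orthoproj1 phi.
Proof.
move=> phi1 Ah pA.
have Ap : A *m orthoproj1 phi = A.
  by rewrite -{2}Ah -{2}pA trmx_mul map_mxM orthoproj1_herm Ah.
by have := orthoproj1_sandwich phi A; rewrite pA Ap.
Qed.

(** S vanishes on the orthogonal complement of phi: with M = S (1 - p),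
    M^* M = (1 - p) S^2 (1 - p) = 0.  So S lives on the line of phi. *)
Lemma sqrt_orthoproj1 d (phi : 'cV[C]_d) (S : 'M[C]_d) c :
  dotc phi phi = 1 -> S ^t* = S -> S *m S = c *: orthoproj1 phi ->
  exists2 s, s * s = c & S = s *: orthoproj1 phi.
Proof.
move=> phi1 Sh SS; have [_ pp _] := orthoproj1P phi1.
set p := orthoproj1 phi in SS pp *.
have Sp : S *m p = S.
  apply/eqP; rewrite eq_sym -subr_eq0; apply/eqP/mxC_sqr0.
  have -> : (S - S *m p) ^t* = S - p *m S.
    by rewrite linearB /= map_mxB trmx_mul map_mxM Sh orthoproj1_herm.
  rewrite mulmxBl !mulmxBr !mulmxA -[p *m S *m S]mulmxA SS.
  by rewrite -!scalemxAr -!scalemxAl !pp !subrr.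
have pS : p *m S = S by rewrite -{2}Sh -{2}Sp trmx_mul map_mxM orthoproj1_herm Sh.
have SE : S = \tr S *: p by exact: hermitian_lineE.
exists (\tr S) => //; move: SS; rewrite SE -scalemxAl -scalemxAr pp scalerA.
move/(congr1 mxtrace); rewrite !linearZ /= mxtrace_orthoproj1 phi1.
by rewrite !mulr1.
Qed.

End Hermitian.

(** * Rank-1 POVMs and their transition matrix *)

Section Rank1Povm.
Local Open Scope sesquilinear_scope.
Variables (C : numClosedFieldType) (d k : nat) (Pi : 'I_k -> 'M[C]_d).
Variable phi : 'I_k -> 'cV[C]_d.
Hypotheses (hPi : is_rank1_povm Pi) (hphi : povm_vectors Pi phi).

Let c : C := d%:R / k%:R.

(** The image condition makes Pi_i a multiple of rho_i; the factor is its
    trace, which is the same for all i while the traces sum to d. *)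
Lemma rank1_effectE i : Pi i = c *: orthoproj1 (phi i).
Proof.
have [[Pi0 PiS] Pit _] := hPi.
have [[[Pih _] _] [phi1 im]] := (Pi0 i, hphi i).
have PE : Pi i = \tr (Pi i) *: orthoproj1 (phi i).
  apply: hermitian_lineE => //; first exact: hermsymmx_adjoint.
  apply/matrixP => x y.
  have : Pi i *m delta_mx y 0 \in <[phi i]>%VS.
    rewrite -im; apply/memv_imgP; exists (delta_mx y 0); first exact: memvf.
    by rewrite lfunE.
  move=> /vlineP[a aE].
  have <- : (Pi i *m (delta_mx y 0 : 'cV_d)) x 0 = Pi i x y.
    by rewrite -colE mxE.
  have <- : (orthoproj1 (phi i) *m Pi i *m (delta_mx y 0 : 'cV_d)) x 0
            = (orthoproj1 (phi i) *m Pi i) x y by rewrite -colE mxE.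
  by rewrite -mulmxA aE -scalemxAr orthoproj1_mul phi1 scale1r.
suff <- : \tr (Pi i) = c by [].
have k0 : (k%:R : C) != 0 by rewrite pnatr_eq0 -lt0n (leq_ltn_trans _ (ltn_ord i)).
apply: (mulIf k0); rewrite divfK// -[d%:R]mxtrace1 -PiS linear_sum /=.
by rewrite (eq_bigr (fun=> \tr (Pi i))) ?sumr_const ?card_ord ?mulr_natr// => j _.
Qed.

(** The state after outcome [j] does not remember the state before it; this
    is what makes the outcome process a Markov chain. *)
Lemma luders_instrumentE j X :
  sqrtmx (Pi j) *m X *m sqrtmx (Pi j) = \tr (Pi j *m X) *: orthoproj1 (phi j).
Proof.
have [[Pi0 _] _ _] := hPi.
have [[Sh _] SS] := sqrtmxP (Pi0 j).1.
have := sqrt_orthoproj1 (hphi j).1 (hermsymmx_adjoint Sh).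
rewrite SS => /(_ _ (rank1_effectE j))[s ss ->].
rewrite -!scalemxAl -!scalemxAr orthoproj1_sandwich !scalerA ss.
by rewrite rank1_effectE -scalemxAl linearZ.
Qed.

Lemma sqrt_effect_mul j : exists2 s, s * s = c &
  forall v, sqrtmx (Pi j) *m v = s *: (dotc (phi j) v *: phi j).
Proof.
have [[Pi0 _] _ _] := hPi.
have [[Sh _] SS] := sqrtmxP (Pi0 j).1.
have := sqrt_orthoproj1 (hphi j).1 (hermsymmx_adjoint Sh).
rewrite SS => /(_ _ (rank1_effectE j))[s ss ->]; exists s => // v.
by rewrite -scalemxAl orthoproj1_mul.
Qed.

(** The completeness relation of the POVM, read as a tight frame identity. *)
Lemma frame_expansion v : v = c *: \sum_i (dotc (phi i) v *: phi i).
Proof.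
have [[_ PiS] _ _] := hPi.
rewrite -{1}[v]mul1mx -PiS mulmx_suml scaler_sumr; apply: eq_bigr => i _.
by rewrite rank1_effectE -scalemxAl orthoproj1_mul.
Qed.

Variable U : 'M[C]_d.
Hypothesis hU : U \is unitarymx.
Local Notation Q := (transition_mx U Pi phi).

Lemma transition_mxE i j : Q i j = c * `|dotc (phi j) (U *m phi i)| ^+ 2.
Proof.
rewrite mxE /outcome_prob rank1_effectE -!scalemxAl linearZ /=; congr (_ * _).
have -> : orthoproj1 (phi j) *m U *m orthoproj1 (phi i) *m U ^t*
        = orthoproj1 (phi j) *m (U *m phi i) *m (U *m phi i) ^t*.
  by rewrite trmx_mul map_mxM !mulmxA.
rewrite orthoproj1_mul -scalemxAl linearZ /= mxtrace_mulC.
rewrite [X in \tr X]mx11_scalar mxtrace_scalar -/(dotc _ _) dotcC.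
by rewrite normCK conjCK mulr1n.
Qed.

Lemma transition_mx_ge0 i j : 0 <= Q i j.
Proof. by rewrite transition_mxE mulr_ge0 ?exprn_ge0// divr_ge0. Qed.

Let c_neq0 (i : 'I_k) : c != 0.
Proof.
apply/eqP => c0; have := hphi i.
have [[/(_ i)[_ []]]] := hPi.
by rewrite rank1_effectE c0 scale0r.
Qed.

Lemma transition_mx_eq0 i j : Q i j = 0 <-> dotc (phi j) (U *m phi i) = 0.
Proof.
rewrite transition_mxE; split => [/eqP|->]; last by rewrite normr0 expr0n mulr0.
by rewrite mulf_eq0 (negbTE (c_neq0 i)) expf_eq0 normr_eq0 => /eqP.
Qed.

Let UstarU : U ^t* *m U = 1%:M.
Proof. by apply/mulmx1C/unitarymxP. Qed.

Lemma transition_mx_row_sum i : \sum_j Q i j = 1.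
Proof.
have [[_ PiS] _ _] := hPi.
under eq_bigr => j _ do rewrite mxE /outcome_prob -!mulmxA.
rewrite -linear_sum -mulmx_suml /= PiS mul1mx mxtrace_mulC -!mulmxA UstarU mulmx1.
by rewrite -/(orthoproj1 _) mxtrace_orthoproj1 (hphi i).1.
Qed.

(** The sum over [i] turns the states rho_i into a multiple of the identity,
    again by completeness. *)
Lemma transition_mx_col_sum j : \sum_i Q i j = 1.
Proof.
have [[_ PiS] _ _] := hPi.
under eq_bigr => i _ do
  rewrite mxE /outcome_prob rank1_effectE -!scalemxAl scalemxAl scalemxAr -rank1_effectE.
rewrite -linear_sum /=.
rewrite -mulmx_suml -mulmx_sumr PiS mulmx1 -mulmxA.
by rewrite (unitarymxP hU) mulmx1 mxtrace_orthoproj1 (hphi j).1.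
Qed.

(** Given an invariant V, the absorbing set is the set of a with phi_a in V:
    it is nonempty because U v is a nonzero combination of the phi_b with
    <phi_b, U v> nonzero, and it is proper because the phi_a span the space. *)
Lemma no_proper_absorbing_irreducible :
  no_proper_absorbing Q -> irreducible_family (fun i => sqrtmx (Pi i) *m U).
Proof.
move=> Qabs [V [[V0 VT] Vinv]].
have phiV a v : v \in V -> dotc (phi a) (U *m v) != 0 -> phi a \in V.
  move=> vV av; have [s ss sE] := sqrt_effect_mul a.
  have s0 : s != 0.
    by apply: contra_neq (c_neq0 a) => s0; rewrite -ss s0 mulr0.
  have : s *: (dotc (phi a) (U *m v) *: phi a) \in V.
    apply: (subvP (Vinv a)); rewrite -sE; apply/memv_imgP; exists v => //.
    by rewrite lfunE /= mulmxA.
  by rewrite !rpredZeq (negbTE s0) (negbTE av).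
pose S := [set a | phi a \in V].
have Sabs : absorbing Q S.
  move=> a b; rewrite !inE => aV bV.
  by apply/transition_mx_eq0/eqP; apply: contraNT bV => /phiV; exact.
have [a aS] : exists a, a \in S.
  have vV := memv_pick V; set v := vpick V in vV.
  have v0 : v != 0 by rewrite vpick0; exact/eqP.
  apply/existsP; apply: contraNT v0; rewrite negb_exists => /forallP Sv.
  have Uv0 : U *m v = 0.
    rewrite [LHS]frame_expansion big1 ?scaler0// => a _.
    have := Sv a; rewrite inE => aV; rewrite (_ : dotc _ _ = 0) ?scale0r//.
    by apply/eqP; apply: contraNT aV; exact: phiV.
  by rewrite -[v]mul1mx -UstarU -mulmxA Uv0 mulmx0.
apply: VT; apply/eqP; rewrite eqEsubv subvf; apply/subvP => v _.
rewrite [v]frame_expansion memvZ// memv_suml// => b _; rewrite memvZ//.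
by have := Qabs S Sabs a b aS; rewrite inE.
Qed.

Definition splits_frame (W : {vspace 'cV[C]_d}) : Prop :=
  [/\ nontrivial_vspace W, (opfun U @: W)%VS = W
    & forall i, phi i \in W \/ in_orthov W (phi i)].

(** The projection onto phi_i maps W into W as soon as phi_i lies in W or is
    orthogonal to it, and U preserves W. *)
Lemma irreducible_no_split :
  irreducible_family (fun i => sqrtmx (Pi i) *m U) ->
  ~ exists W, splits_frame W.
Proof.
move=> irr [W [Wnt UW Wphi]]; apply: irr; exists W; split=> // i.
apply/subvP => _ /memv_imgP[w wW ->]; rewrite lfunE /= -mulmxA.
have UwW : U *m w \in W.
  by rewrite -UW; apply/memv_imgP; exists w; rewrite // lfunE.
have [s _ ->] := sqrt_effect_mul i; apply: memvZ.
have [iW|iW] := Wphi i; first exact: memvZ.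
by rewrite dotcC iW// conjC0 scale0r mem0v.
Qed.

(** W is the span of the phi_a with a in S.  Absorption says that U phi_a is
    orthogonal to phi_b for b outside S; the frame expansion then puts U phi_a
    in W, so U W = W by dimension, and phi_b is orthogonal to U W = W. *)
Lemma no_split_no_proper_absorbing :
  ~ (exists W, splits_frame W) -> no_proper_absorbing Q.
Proof.
move=> nosplit S Sabs a b aS; apply/negPn/negP => bS; apply: nosplit.
pose W := <<map phi (enum S)>>%VS.
have phiW i : i \in S -> phi i \in W.
  by move=> iS; apply: memv_span; rewrite map_f ?mem_enum.
have Uinj : lker (opfun U) == 0%VS.
  apply/lker0P => u v; rewrite !lfunE /= => /(congr1 (mulmx (U ^t* ))).
  by rewrite !mulmxA UstarU !mul1mx.
have UW : (opfun U @: W)%VS = W.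
  apply/eqP; rewrite eqEdim limg_dim_eq ?leqnn ?andbT; last first.
    by rewrite (eqP Uinj) capv0.
  rewrite limg_span; apply/span_subvP => _ /mapP[_ /mapP[i iS ->] ->]; rewrite mem_enum in iS.
  rewrite lfunE /= [U *m _]frame_expansion memvZ// memv_suml// => j _.
  have [jS|jS] := boolP (j \in S); first by rewrite memvZ ?phiW.
  by have /transition_mx_eq0-> := Sabs i j iS jS; rewrite scale0r mem0v.
have orthW i : i \notin S -> in_orthov W (phi i).
  move=> iS w wW; have : w \in lker (opfun (orthoproj1 (phi i))).
    apply: (subvP _ w wW); rewrite -UW limg_span.
    apply/span_subvP => _ /mapP[_ /mapP[j jS ->] ->]; rewrite mem_enum in jS.
    rewrite memv_ker !lfunE /= orthoproj1_mul.
    by have /transition_mx_eq0-> := Sabs j i jS iS; rewrite scale0r.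
  rewrite memv_ker lfunE /= orthoproj1_mul => /eqP/(congr1 (dotc (phi i))).
  by rewrite dotcZr (hphi i).1 mulr1 dotc0r => iw; rewrite dotcC iw conjC0.
have phi0 i : phi i != 0.
  apply: contraTneq (oner_neq0 C) => i0.
  by rewrite -(hphi i).1 i0 dotc0r eqxx.
exists W; split=> // [|i]; last first.
  by have [/phiW|/orthW] := boolP (i \in S); [left|right].
split=> WE.
  by have := phiW a aS; rewrite WE memv0 (negbTE (phi0 a)).
have /(_ (phi b)) := orthW b bS; rewrite WE memvf => /(_ isT)/eqP.
by rewrite (hphi b).1 oner_eq0.
Qed.

End Rank1Povm.

(** * Cylinders in the space of outcome sequences *)

Section SequenceSpace.
Local Open Scope classical_set_scope.
Variable k : nat.
Local Notation T := (seq_space k).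
Local Notation shift := (@left_shift 'I_k.+1 : T -> T).

(** Cylinders indexed by words of arbitrary length: the empty word gives the
    whole space, and induction on words becomes available. *)
Definition cyl (s : seq 'I_k.+1) : set T := cylinder (in_tuple s).

Lemma cylP s x : cyl s x <-> forall j, (j < size s)%N -> x j = nth ord0 s j.
Proof.
split=> [xs j js | xs j]; last by rewrite (tnth_nth ord0) xs.
by have := xs (Ordinal js); rewrite (tnth_nth ord0).
Qed.

Lemma cylinder_cyl n (w : n.-tuple 'I_k.+1) : cylinder w = cyl w.
Proof.
apply/seteqP; split => x /=.
  move=> xw; apply/cylP => j; rewrite size_tuple => jn.
  by rewrite (xw (Ordinal jn)) (tnth_nth ord0).
by move=> /cylP xw j; rewrite (tnth_nth ord0) xw ?size_tuple.
Qed.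

Lemma cyl_nil : cyl [::] = setT.
Proof. by apply/seteqP; split=> // x _; apply/cylP. Qed.

Lemma cyl1P i x : cyl [:: i] x <-> x 0%N = i.
Proof. by rewrite cylP; split=> [->//|xi [|]]. Qed.

Lemma cyl_cons i s : cyl (i :: s) = cyl [:: i] `&` shift @^-1` cyl s.
Proof.
apply/seteqP; split => x.
  move=> /cylP xis; split; first by apply/cyl1P; exact: (xis 0%N).
  by apply/cylP => j js; exact: (xis j.+1).
move=> [/cyl1P xi /cylP xs]; apply/cylP => -[|j]; first by rewrite xi.
exact: xs.
Qed.

Lemma setI_cyl1 i j s :
  cyl [:: j] `&` cyl (i :: s) = if i == j then cyl (i :: s) else set0.
Proof.
case: eqP => [->|ij]; first by apply/setIidPr; rewrite cyl_cons; exact: subIsetl.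
by apply/seteqP; split=> // x [/cyl1P xj]; rewrite cyl_cons => -[/cyl1P xi _];
  apply: ij; rewrite -xi -xj.
Qed.

Lemma measurable_cyl s : measurable (cyl s).
Proof.
case: s => [|i s]; first by rewrite cyl_nil.
by apply: sub_sigma_algebra; exists (size s), (in_tuple (i :: s)).
Qed.

Lemma measurable_left_shift : measurable_fun setT shift.
Proof.
apply: (@measurability _ _ T T setT shift (@cylinders k.+1)) => //.
move=> _ [_ [n [w ->]] <-]; rewrite setTI cylinder_cyl.
have -> : shift @^-1` cyl w = \bigcup_i cyl (i :: w).
  apply/seteqP; split => x.
    by move=> xw; exists (x 0%N) => //; rewrite cyl_cons; split=> //; apply/cyl1P.
  by move=> [i _]; rewrite cyl_cons => -[].
by apply: fin_bigcup_measurable => [|i _]; [exact: finite_finset|exact: measurable_cyl].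
Qed.

(** Two cylinders are nested or disjoint, so together with the empty set they
    form a pi-system generating the sigma-algebra. *)
Lemma eq_measure_cyl (R : realType) (m1 m2 : {measure set T -> \bar R}) :
  (m1 setT < +oo)%E -> (forall s, m1 (cyl s) = m2 (cyl s)) ->
  forall B, measurable B -> m1 B = m2 B.
Proof.
move=> m1oo m12; pose G := [set A | A = set0 \/ exists s, A = cyl s].
apply: (measure_unique G (fun=> setT)) => //.
- apply/seteqP; split; apply: smallest_sub.
  + exact: smallest_sigma_algebra.
  + move=> _ [n [w ->]]; apply: sub_sigma_algebra; right.
    by exists w; rewrite cylinder_cyl.
  + exact: sigma_algebra_measurable.
  + by move=> A [->|[s ->]] //; exact: measurable_cyl.
- have GI s t : (size s <= size t)%N -> G (cyl s `&` cyl t).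
    move=> st; have [[x [/cylP xs /cylP xt]]|no] := pselect (cyl s `&` cyl t !=set0).
      right; exists t; apply/setIidPr => y /cylP yt; apply/cylP => j js.
      by rewrite -xs// yt ?xt// (leq_trans js).
    by left; apply/seteqP; split=> // x stx; apply: no; exists x.
  move=> A B [->|[s ->]]; first by rewrite set0I; left.
  move=> [->|[t ->]]; first by rewrite setI0; left.
  by have [/GI//|/ltnW/GI] := leqP (size s) (size t); rewrite setIC.
- by move=> _; right; exists [::]; rewrite cyl_nil.
- by rewrite bigcup_const.
- by move=> A [->|[s ->]]; rewrite ?measure0.
Qed.

Lemma measure_fibers (R : realType) (m : {measure set T -> \bar R})
    (f : T -> 'I_k.+1) (B : set T) :
  (forall i, measurable (f @^-1` [set i])) -> measurable B ->
  m B = (\sum_i m (f @^-1` [set i] `&` B))%E.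
Proof.
move=> mf mB.
rewrite -measure_bigsetU_ord; last first.
- apply/trivIsetP => i j _ _ ij; apply/seteqP; split=> // x [[fi _] [fj _]].
  by move: ij; rewrite -fi -fj eqxx.
- by move=> i; exact: measurableI.
congr (m _); apply/seteqP; split => x.
  by move=> Bx; rewrite -bigcup_mkord_ord; exists (f x) => //=; rewrite inord_val.
by rewrite -bigcup_mkord_ord => -[i _ []].
Qed.

End SequenceSpace.

(** * Ergodicity of stationary Markov chains with uniform marginals *)

Section UniformMarkov.
Local Open Scope classical_set_scope.
Variables (R : realType) (k : nat) (q : 'M[R]_k.+1).
Local Notation T := (seq_space k).
Local Notation shift := (@left_shift 'I_k.+1 : T -> T).
Variable P : probability T R.

Fixpoint path_weight (i : 'I_k.+1) (s : seq 'I_k.+1) : R :=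
  if s is j :: s' then q i j * path_weight j s' else 1.

Definition uniform_markov : Prop :=
  forall i s, P (cyl (i :: s)) = (k.+1%:R^-1 * path_weight i s)%:E.

Hypotheses (q_ge0 : forall i j, 0 <= q i j)
  (q_row : forall i, \sum_j q i j = 1) (q_col : forall j, \sum_i q i j = 1).
Hypothesis markovP : uniform_markov.

Let p (B : set T) : R := fine (P B).

Let pE B : measurable B -> P B = (p B)%:E.
Proof. by move=> mB; rewrite fineK// fin_num_measure. Qed.

Let mT B : measurable B -> measurable (shift @^-1` B).
Proof. by move=> mB; rewrite -[X in measurable X]setTI; exact: measurable_left_shift. Qed.

Let mcyl := @measurable_cyl k.

(** Both sides are finite measures in [B], so it suffices to compare them on
    cylinders, where this is the defining product formula. *)
Lemma markov_one_step i j B : measurable B ->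
  p (cyl [:: i] `&` shift @^-1` (cyl [:: j] `&` B)) = q i j * p (cyl [:: j] `&` B).
Proof.
move=> mB; apply: EFin_inj; rewrite EFinM -!pE; last first.
- by apply: measurableI => //; apply: mT; exact: measurableI.
- exact: measurableI.
pose m1 := mrestr (pushforward (mrestr P (mcyl [:: i])) shift) (mcyl [:: j]).
pose m2 := mscale (NngNum (q_ge0 i j)) (mrestr P (mcyl [:: j])).
suff : m1 B = m2 B.
  by rewrite /m1 /m2 /mscale /mrestr /pushforward /= setIC [cyl [:: j] `&` B]setIC.
rewrite {}/m1 {}/m2; apply: eq_measure_cyl => //;
  first (exact: measurable_left_shift); move=> ms; rewrite /= /mrestr /pushforward.
  rewrite pE ?ltry//; apply: measurableI => //; apply: mT.
  exact: measurableI.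
move=> s; rewrite /mscale /= /mrestr setIC [cyl s `&` _]setIC.
case: s => [|a s].
  rewrite cyl_nil setIT -cyl_cons !markovP -EFinM /=.
  by rewrite !mulr1 mulrC.
rewrite setI_cyl1; case: eqP => [->|_]; last first.
  by rewrite preimage_set0 setI0 !measure0 mule0.
by rewrite -cyl_cons !markovP -EFinM /= mulrCA.
Qed.

Let cyl1E i : cyl [:: i] = (fun x : T => x 0%N) @^-1` [set i].
Proof. by apply/seteqP; split=> x /cyl1P. Qed.

Lemma sum_cyl1 B : measurable B -> p B = \sum_i p (cyl [:: i] `&` B).
Proof.
move=> mB; apply: EFin_inj; rewrite -pE//.
rewrite (@measure_fibers _ _ P (fun x => x 0%N))//; last first.
  by move=> i; rewrite -cyl1E.
rewrite -sumEFin; apply: eq_bigr => i _.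
by rewrite -cyl1E; apply: pE; exact: measurableI.
Qed.

Lemma markov_step i B : measurable B ->
  p (cyl [:: i] `&` shift @^-1` B) = \sum_j q i j * p (cyl [:: j] `&` B).
Proof.
move=> mB; have mB' : measurable (cyl [:: i] `&` shift @^-1` B).
  by apply: measurableI => //; exact: mT.
have fE j : (fun x : T => x 1%N) @^-1` [set j] = shift @^-1` cyl [:: j].
  by rewrite cyl1E.
apply: EFin_inj; rewrite -pE// (@measure_fibers _ _ P (fun x => x 1%N))//.
  rewrite -sumEFin; apply: eq_bigr => j _.
  rewrite -markov_one_step// fE setICA -preimage_setI; apply: pE.
  by apply: measurableI => //; apply: mT; exact: measurableI.
by move=> j; rewrite fE; exact: mT.
Qed.

Lemma markov_shift_invariant B : measurable B -> P (shift @^-1` B) = P B.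
Proof.
move=> mB; rewrite !pE//; last exact: mT.
congr _%:E; rewrite sum_cyl1 ?[RHS]sum_cyl1//; last exact: mT.
under eq_bigr do rewrite markov_step//.
by rewrite exchange_big /=; apply: eq_bigr => j _; rewrite -mulr_suml q_col mul1r.
Qed.

(** Maximum principle: the value at a maximiser is an average of values that
    are at most the maximum, so the maximisers form an absorbing set. *)
Lemma harmonic_constant (h : 'I_k.+1 -> R) : no_proper_absorbing q ->
  (forall i, h i = \sum_j q i j * h j) -> forall i j, h i = h j.
Proof.
move=> qabs hh; have [m hm] : exists m, forall i, h i <= h m.
  by exists [arg max_(i > ord0) h i]%O; case: arg_maxP => // m _ hm i; exact: hm.
suff hE i : h i = h m by move=> i j; rewrite !hE.
pose S := [set i : 'I_k.+1 | h i == h m]%SET.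
have Sabs : absorbing q S.
  move=> a b; rewrite !inE => /eqP am bm.
  have /eqP : \sum_j q a j * (h m - h j) = 0.
    under eq_bigr do rewrite mulrBr.
    by rewrite sumrB -mulr_suml q_row mul1r -hh am subrr.
  rewrite psumr_eq0 => [/allP/(_ b)|j _]; last by rewrite mulr_ge0 ?subr_ge0.
  rewrite mem_index_enum mulf_eq0 subr_eq0 [h m == _]eq_sym (negbTE bm) orbF.
  by move=> /(_ isT)/eqP.
by have := qabs S Sabs m i; rewrite !inE eqxx => /(_ isT)/eqP.
Qed.

(** An invariant event A meets all the cylinders of length 1 in the same
    probability; the Markov property extends this to independence of A from
    all cylinders, hence from every event and from A itself. *)
Lemma no_proper_absorbing_ergodic : no_proper_absorbing q -> ergodic P shift.
Proof.
move=> qabs; split=> [||A mA invA]; first exact: measurable_left_shift.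
  exact: markov_shift_invariant.
pose h i := p (cyl [:: i] `&` A).
have hharm i : h i = \sum_j q i j * h j by rewrite -markov_step// invA.
have hE i : h i = k.+1%:R^-1 * p A.
  have -> : p A = k.+1%:R * h i.
    rewrite sum_cyl1// (eq_bigr (fun=> h i)) ?sumr_const ?card_ord ?mulr_natl//.
    by move=> j _; exact: (harmonic_constant qabs hharm).
  by rewrite mulKf// pnatr_eq0.
have indep s : P (cyl s `&` A) = (P (cyl s) * P A)%E.
  case: s => [|i s]; first by rewrite cyl_nil setTI probability_setT mul1e.
  rewrite markovP !pE//; last exact: measurableI.
  rewrite -EFinM; congr _%:E; elim: s i => [|j s IHs] i.
    by rewrite -/(h i) hE /= mulr1.
  have -> : cyl [:: i, j & s] `&` A
           = cyl [:: i] `&` shift @^-1` (cyl [:: j] `&` (cyl (j :: s) `&` A)).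
    by rewrite (setIA (cyl [:: j])) setI_cyl1 eqxx preimage_setI invA setIA -cyl_cons.
  rewrite markov_one_step; last exact: measurableI.
  by rewrite setIA setI_cyl1 eqxx IHs /= !mulrA [q i j * _]mulrC.
have pA0 : 0 <= p A by exact: fine_ge0.
have : P (A `&` A) = (P A * P A)%E.
  pose m1 := mrestr P mA; pose m2 := mscale (NngNum pA0) P.
  suff m12 : m1 A = m2 A by rewrite [X in (X * _)%E]pE//; exact: m12.
  rewrite {}/m1 {}/m2; apply: eq_measure_cyl => // [|s].
    by rewrite /= /mrestr setTI (pE mA) ltry.
  by rewrite /= /mscale /mrestr /= -pE// indep muleC.
rewrite setIid !pE// -EFinM => -[] /eqP.
rewrite -subr_eq0 -{1}[p A]mulr1 -mulrBr mulf_eq0 subr_eq0.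
by move=> /orP[/eqP->|/eqP <-]; [left|right].
Qed.

(** The mass of the block S x S is #|S| by rows; by columns it is #|S| minus
    the mass entering S from outside, which therefore vanishes. *)
Lemma absorbing_setC (S : {set 'I_k.+1}) : absorbing q S ->
  forall a b, a \notin S -> b \in S -> q a b = 0.
Proof.
move=> Sabs a b aS bS.
have rows : \sum_(i in S) \sum_(j in S) q i j = #|S|%:R.
  rewrite -sumr_const; apply: eq_bigr => i iS.
  rewrite -(q_row i) big_mkcond; apply: eq_bigr => j _.
  by case: ifPn => // jS; rewrite Sabs.
have : \sum_(j in S) \sum_(i | i \notin S) q i j = 0.
  have : \sum_(j in S) \sum_i q i j = #|S|%:R.
    by rewrite -sumr_const; apply: eq_bigr => j _.
  under eq_bigr => j _ do rewrite (bigID (mem S))/=.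
  rewrite big_split/= exchange_big/= rows => /eqP.
  by rewrite -subr_eq0 addrAC subrr add0r => /eqP.
move=> /eqP; rewrite psumr_eq0 => [/allP/(_ b)|j _]; last exact: sumr_ge0.
rewrite mem_index_enum bS /= psumr_eq0// => /(_ isT)/allP/(_ a).
by rewrite mem_index_enum aS => /(_ isT)/eqP.
Qed.

Lemma measurable_coord (Q : 'I_k.+1 -> Prop) n :
  measurable ([set x | Q (x n)] : set T).
Proof.
elim: n => [|n IHn]; last exact: (mT IHn).
rewrite (_ : [set x : T | Q (x 0%N)] = \bigcup_(i in [set i | Q i]) cyl [:: i]).
  by apply: fin_bigcup_measurable => //; exact: finite_finset.
apply/seteqP; split=> x /=; first by move=> Qx; exists (x 0%N) => //; apply/cyl1P.
by move=> [i /= Qi /cyl1P xi]; rewrite xi.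
Qed.

Definition forbidden_at n : set T := [set x | q (x n) (x n.+1) = 0].

Lemma forbidden_negligible n : measurable (forbidden_at n) /\ P (forbidden_at n) = 0%E.
Proof.
elim: n => [|n [mN PN]]; last first.
  by split; [exact: (mT mN) | rewrite -PN; exact: markov_shift_invariant].
pose F i : set T := [set x | q i (x 0%N) = 0].
have mF i : measurable (F i) by exact: (measurable_coord (fun j => q i j = 0) 0).
have NE i : cyl [:: i] `&` forbidden_at 0 = cyl [:: i] `&` shift @^-1` F i.
  by apply/seteqP; split=> x [xi qx]; split=> //; move: xi qx => /cyl1P;
    rewrite /forbidden_at /F /= => ->.
have mN : measurable (forbidden_at 0).
  rewrite (_ : forbidden_at 0 = \bigcup_i (cyl [:: i] `&` shift @^-1` F i)).
    apply: fin_bigcup_measurable => [|i _]; first exact: finite_finset.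
    by apply: measurableI => //; exact: mT.
  apply/seteqP; split=> x; last by move=> [i _]; rewrite -NE => -[].
  by move=> Nx; exists (x 0%N) => //; rewrite -NE; split=> //; apply/cyl1P.
split=> //; rewrite pE// sum_cyl1// big1// => i _.
rewrite NE markov_step// big1// => j _.
have [->|qij] := eqVneq (q i j) 0; first by rewrite mul0r.
rewrite (_ : _ `&` _ = set0) ?/p ?measure0 ?mulr0//.
by apply/seteqP; split=> // x [/cyl1P xj]; rewrite /F /= xj => /eqP; rewrite (negbTE qij).
Qed.

(** Outside the null event that some transition of probability 0 occurs, a
    trajectory stays in S or stays outside S for ever.  Visiting S infinitely
    often (rather than starting in S) gives an event that is invariant exactly,
    not only up to a null set. *)
Lemma ergodic_no_proper_absorbing : ergodic P shift -> no_proper_absorbing q.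
Proof.
move=> [_ _ erg] S Sabs a b aS; apply/negPn/negP => bS.
pose E n : set T := [set x | x n \in S].
(* The event that S is visited infinitely often. *)
pose A := \bigcap_N \bigcup_n E (N + n)%N.
have mA : measurable A.
  apply: bigcapT_measurable => N; apply: bigcupT_measurable => n.
  exact: (measurable_coord (fun i => i \in S)).
have invA : shift @^-1` A = A.
  apply/seteqP; split=> x xA N _.
    by have [n _ xn] := xA N I; exists n.+1 => //; rewrite addnS.
  by have [n _ xn] := xA N.+1 I; exists n.
pose N := \bigcup_n forbidden_at n.
have N0 : P.-negligible N.
  apply: negligible_bigcup => n; have [mN PN] := forbidden_negligible n.
  by exists (forbidden_at n); split.
have stay x n : ~ N x -> (x n \in S) = (x 0%N \in S).
  move=> Nx; elim: n => // n <-.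
  have qx : q (x n) (x n.+1) != 0 by apply/eqP => qx; apply: Nx; exists n.
  have [xS|xS] := boolP (x n \in S).
    by apply: contraNT qx => xS'; rewrite Sabs.
  by apply: contraNF qx => xS'; rewrite (absorbing_setC Sabs).
have nullE i (B : set T) : P.-negligible B -> ~ cyl [:: i] `<=` B `|` N.
  move=> B0 /negligibleS/(_ (negligibleU B0 N0))/(measure_negligible (mcyl _)) P0.
  have := etrans (esym (markovP i [::])) P0.
  by rewrite /= mulr1 => -[] /eqP; rewrite invr_eq0 pnatr_eq0.
have [PA0|PA1] := erg A mA invA.
  apply: (nullE a A); first exact/negligibleP.
  move=> x /cyl1P xa; have [Nx|Nx] := pselect (N x); [by right|left=> M _].
  by exists 0%N => //; rewrite /E /= stay// xa.
apply: (nullE b (~` A)).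
  apply/negligibleP; first exact: measurableC.
  by have := probability_setC P mA; rewrite PA1 subee.
move=> x /cyl1P xb; have [Nx|Nx] := pselect (N x); [by right|left=> xA].
by have [n _] := xA 0%N I; rewrite /E /= stay// xb (negbTE bS).
Qed.

End UniformMarkov.

(** * The Kusuoka measure of a rank-1 POVM *)

Section KusuokaMarkov.
Local Open Scope complex_scope.
Local Open Scope sesquilinear_scope.
Variables (R : realType) (d k : nat) (U : 'M[R[i]]_d).
Variables (Pi : 'I_k.+1 -> 'M[R[i]]_d) (phi : 'I_k.+1 -> 'cV[R[i]]_d).
Hypotheses (hd : (0 < d)%N) (hU : U \is unitarymx).
Hypotheses (hPi : is_rank1_povm Pi) (hphi : povm_vectors Pi phi).
Local Notation Q := (transition_mx U Pi phi).

(** The transition probabilities as elements of [R], where the measure takes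
    its values. *)
Definition real_transition_mx : 'M[R]_k.+1 := map_mx (@complex.Re R) Q.
Local Notation q := real_transition_mx.

Lemma real_transition_mxE : map_mx (real_complex R) q = Q.
Proof.
apply/matrixP => i j; rewrite 2!mxE; apply: RRe_real.
by apply: ger0_real; apply: transition_mx_ge0.
Qed.

Lemma real_transition_no_proper_absorbing :
  no_proper_absorbing q <-> no_proper_absorbing Q.
Proof.
have E S : absorbing q S <-> absorbing Q S.
  rewrite -real_transition_mxE; split=> abs a b aS bS.
    by rewrite mxE abs// rmorph0.
  apply: (fmorph_inj (real_complex R)); rewrite rmorph0.
  by have := abs a b aS bS; rewrite mxE.
by split=> abs S /E; exact: abs.
Qed.

Lemma real_transition_ge0 i j : 0 <= q i j.
Proof.
by have := transition_mx_ge0 hPi hphi U i j; rewrite -real_transition_mxE mxE ler0c.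
Qed.

(** Each measurement multiplies the weight by one transition probability and
    resets the state to the projection of the last outcome. *)
Lemma mxtrace_post_state x i s :
  \tr (post_state U Pi (x *: orthoproj1 (phi i)) s) = x * (path_weight q i s)%:C.
Proof.
elim: s x i => [|j s IHs] x i /=.
  by rewrite linearZ /= mxtrace_orthoproj1 (hphi i).1 rmorph1.
have -> : sqrtmx (Pi j) *m U *m (x *: orthoproj1 (phi i)) *m U ^t* *m sqrtmx (Pi j)
        = (x * Q i j) *: orthoproj1 (phi j).
  rewrite -scalemxAr -!scalemxAl -scalerA; congr (_ *: _).
  rewrite -!(mulmxA (sqrtmx (Pi j))) mulmxA (luders_instrumentE hPi hphi).
  by rewrite mxE /outcome_prob !mulmxA.
rewrite IHs -real_transition_mxE rmorphM mulrA; congr (_ * _ * _).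
by rewrite [LHS]mxE.
Qed.

(** The first measurement turns the maximally mixed state I/d into rho_i / k
    (here with [k.+1] outcomes), which gives the uniform initial law. *)
Lemma kusuoka_uniform_markov (P : probability (seq_space k) R) :
  is_kusuoka_measure U Pi P -> uniform_markov q P.
Proof.
move=> hP i s.
rewrite -[LHS]fineK ?fin_num_measure//; last exact: measurable_cyl.
congr _%:E; apply: (fmorph_inj (real_complex R)).
rewrite [LHS](hP (size s) (in_tuple (i :: s))) /= rmorphM.
have -> : sqrtmx (Pi i) *m U *m (d%:R^-1)%:M *m U ^t* *m sqrtmx (Pi i)
        = (k.+1%:R^-1) *: orthoproj1 (phi i).
  rewrite -!(mulmxA (sqrtmx (Pi i))) mulmxA (luders_instrumentE hPi hphi).
  rewrite mul_mx_scalar -scalemxAl (unitarymxP hU) -scalemxAr mulmx1 linearZ /=.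
  rewrite (rank1_effectE hPi hphi) linearZ /= mxtrace_orthoproj1 (hphi i).1 mulr1.
  by rewrite mulKf// pnatr_eq0 -lt0n.
by rewrite mxtrace_post_state fmorphV rmorph_nat.
Qed.

End KusuokaMarkov.

Local Open Scope complex_scope.

Theorem theorem10 (R : realType) (d k : nat) (hd : (2 <= d)%N)
    (U : 'M[R[i]]_d) (hU : U \is unitarymx)
    (Pi : 'I_k.+1 -> 'M[R[i]]_d) (hPi : is_rank1_povm Pi)
    (phi : 'I_k.+1 -> 'cV[R[i]]_d) (hphi : povm_vectors Pi phi)
    (P : probability (seq_space k) R) (hP : is_kusuoka_measure U Pi P) :
  [<-> ergodic P (@left_shift 'I_k.+1);
       irreducible_family (fun i => sqrtmx (Pi i) *m U);
       ~ exists W : {vspace 'cV_d},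
           [/\ nontrivial_vspace W, (opfun U @: W)%VS = W
             & forall i, phi i \in W \/ in_orthov W (phi i)];
       irreducible_stochastic (transition_mx U Pi phi)].
Proof.
have markovP := kusuoka_uniform_markov (ltnW hd) hU hPi hphi hP.
have absE := real_transition_no_proper_absorbing U hPi hphi.
have irrE := irreducible_stochasticP (transition_mx_ge0 hPi hphi U)
  (transition_mx_row_sum hPi hphi hU).
have q0 := real_transition_ge0 U hPi hphi.
have qrow i : \sum_j real_transition_mx U Pi phi i j = 1.
  apply: (fmorph_inj (real_complex R)); rewrite rmorph1 rmorph_sum.
  rewrite -(transition_mx_row_sum hPi hphi hU i); apply: eq_bigr => j _.
  by rewrite -(real_transition_mxE U hPi hphi) [RHS]mxE.
have qcol j : \sum_i real_transition_mx U Pi phi i j = 1.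
  apply: (fmorph_inj (real_complex R)); rewrite rmorph1 rmorph_sum.
  rewrite -(transition_mx_col_sum hPi hphi hU j); apply: eq_bigr => i _.
  by rewrite -(real_transition_mxE U hPi hphi) [RHS]mxE.
tfae.
- move=> /(ergodic_no_proper_absorbing q0 qrow qcol markovP)/absE.
  exact: no_proper_absorbing_irreducible.
- exact: irreducible_no_split.
- by move=> /(no_split_no_proper_absorbing hPi hphi hU)/irrE.
- by move=> /irrE/absE; exact: no_proper_absorbing_ergodic.
Qed.
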